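(* Any proof labeling scheme for $\textsc{Permutation-Recognition}$, and any proof labeling scheme for $\textsc{Trapezoid-Recognition}$, must use certificates of size $\Omega(\log n)$ bits on $n$-node networks.
   Context: A permutation graph is a graph $G=([n],E)$, $[n]=\{0,\dots,n-1\}$ (up to isomorphism), for which there is a permutation $\pi$ of $[n]$ with $\{i,j\}\in E$ iff $(i-j)(\pi(i)-\pi(j))<0$. A trapezoid graph is the intersection graph of trapezoids each having one side on a fixed top horizontal line and one side on a fixed parallel bottom line. $\textsc{Permutation-Recognition}$ (resp. $\textsc{Trapezoid-Recognition}$) is the set of configurations $\langle G,\mathrm{id}\rangle$ with $G$ a permutation (resp. trapezoid) graph. Distributed setting: $G$ is a simple connected $n$-node graph, nodes have unique identifiers in $\{1,\dots,\mathrm{poly}(n)\}$. A proof labeling scheme: an untrusted prover assigns each node a certificate; in one deterministic round each node sees its own id and certificate and those of its neighbors, and accepts or rejects; on yes-instances some assignment makes all nodes accept, on no-instances every assignment makes some node reject. Its size is the maximum certificate length. *)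

(* Defs.v *)
From Stdlib Require Import Rdefinitions.
From mathcomp Require Import all_boot all_fingroup.

Set Implicit Arguments.
Unset Strict Implicit.
Unset Printing Implicit Defensive.

Definition perm_rel (n : nat) (pi : {perm 'I_n}) : rel 'I_n :=
  fun i j => ((i < j) && (pi j < pi i)) || ((j < i) && (pi i < pi j)).

Definition permutation_graph (n : nat) (e : rel 'I_n) : Prop :=
  exists (phi : {perm 'I_n}) (pi : {perm 'I_n}),
    forall u v, e u v = perm_rel pi (phi u) (phi v).

Record trapezoid := Trapezoid { top_l : R; top_r : R; bot_l : R; bot_r : R }.

Definition valid_trapezoid (t : trapezoid) : Prop :=
  Rle (top_l t) (top_r t) /\ Rle (bot_l t) (bot_r t).

(* Two trapezoids (convex hulls of their two sides) are disjoint iff one lies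
   strictly to the left of the other on both lines. *)
Definition trapezoids_intersect (s t : trapezoid) : Prop :=
  ~ ((Rlt (top_r s) (top_l t) /\ Rlt (bot_r s) (bot_l t)) \/
     (Rlt (top_r t) (top_l s) /\ Rlt (bot_r t) (bot_l s))).

Definition trapezoid_graph (n : nat) (e : rel 'I_n) : Prop :=
  exists T : 'I_n -> trapezoid,
    (forall v, valid_trapezoid (T v)) /\
    forall u v, e u v <-> (u != v /\ trapezoids_intersect (T u) (T v)).

Definition configuration (c n : nat) (e : rel 'I_n) (id : 'I_n -> nat) : Prop :=
  [/\ symmetric e, irreflexive e, (forall u v : 'I_n, connect e u v),
      injective id & forall v, 1 <= id v <= n ^ c].

Definition cert := seq bool.

(* What a node v sees of its neighbours in one round: the (identifier,
   certificate) pairs of its neighbours, listed in increasing identifier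
   order (a canonical, port-numbering-free presentation). *)
Definition neighbor_view (n : nat) (e : rel 'I_n) (id : 'I_n -> nat)
    (crt : 'I_n -> cert) (v : 'I_n) : seq (nat * cert) :=
  sort (fun a b => a.1 <= b.1) [seq (id u, crt u) | u <- enum 'I_n & e v u].

Definition verifier := (nat * cert) -> seq (nat * cert) -> bool.

Definition all_accept (V : verifier) (n : nat) (e : rel 'I_n)
    (id : 'I_n -> nat) (crt : 'I_n -> cert) : Prop :=
  forall v, V (id v, crt v) (neighbor_view e id crt v).

Definition is_PLS (c : nat) (P : forall n, rel 'I_n -> Prop)
    (V : verifier) (f : nat -> nat) : Prop :=
  (forall n e id, configuration c e id -> P n e ->
     exists crt : 'I_n -> cert,
       (forall v, size (crt v) <= f n) /\ all_accept V e id crt) /\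
  (forall n e id, configuration c e id -> ~ P n e ->
     forall crt : 'I_n -> cert, ~ all_accept V e id crt).

Definition Omega_log (f : nat -> nat) : Prop :=
  exists a n0 : nat, 0 < a /\ forall n, n0 <= n -> trunc_log 2 n <= a * f n.

(* Main.v *)
(** For a permutation s of t = Theta(n) indices let G_s be the disjoint union
    of t small components, made connected by universal vertices: the component
    of index s(j) is a 4-cycle x1 x2 y2 y1 with a pendant path x1 - p - q,
    where y1, y2 have index j and x1, x2, p, q have index s(j).  These are
    permutation graphs.  With k-bit certificates there are at most
    2^((k+1)n) certificate assignments, so if t! exceeds this number then two
    permutations s <> s' share their certificates.  Attach now the y1's along
    s and the y2's along s': each vertex has the view it has in G_s or in
    G_s' (a universal vertex sees all certificates, which are the same), so
    this mixed graph is accepted.  But where s and s' differ the 4-cycle opens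
    and an induced subdivided claw centered at x1 appears; its leaves form an
    asteroidal triple, which no cocomparability (a fortiori trapezoid) graph
    contains.  Hence t! <= 2^((k+1)n), that is, k = Omega(log n). *)

From Stdlib Require Import Reals Lra.
Require Import Defs.
From mathcomp Require Import all_boot all_fingroup zify.

Set Implicit Arguments.
Unset Strict Implicit.
Unset Printing Implicit Defensive.

(** * Permutation diagrams drawn with arbitrary positions *)

Definition crosses (T : Type) (f g : T -> nat) : rel T :=
  fun u v => ((f u < f v) && (g v < g u)) || ((f v < f u) && (g u < g v)).

Definition rank (T : finType) (f : T -> nat) (u : T) : nat :=
  #|[set w | f w < f u]|.

Lemma ltn_rank (T : finType) (f : T -> nat) (u v : T) :
  (rank f u < rank f v) = (f u < f v).
Proof.
case: (ltnP (f u) (f v)) => huv.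
  apply/proper_card/properP; split.
    by apply/subsetP => w; rewrite !inE => /ltn_trans; apply.
  by exists u; rewrite !inE ?ltnn.
apply/negbTE; rewrite -leqNgt; apply/subset_leq_card/subsetP => w.
by rewrite !inE => /leq_trans; apply.
Qed.

(** Replacing each value by its rank closes the gaps, so diagrams can be drawn with any distinct
    positions. *)
Lemma rank_permutation (n : nat) (f : 'I_n -> nat) :
  injective f -> exists s : {perm 'I_n}, forall u v, (s u < s v) = (f u < f v).
Proof.
move=> f_inj.
have lt_n u : rank f u < n.
  rewrite -[X in _ < X]card_ord -cardsT; apply/proper_card/properP.
  by split; [exact: subsetT | exists u; rewrite !inE ?ltnn].
have s_inj : injective (fun u => Ordinal (lt_n u)).
  move=> u v /(congr1 val)/= eq_rank; apply: f_inj; apply/eqP.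
  rewrite -[_ == _]negbK neq_ltn -(ltn_rank f u) -(ltn_rank f v).
  by rewrite eq_rank ltnn.
by exists (perm s_inj) => u v; rewrite !permE /= ltn_rank.
Qed.

Lemma permutation_graph_crosses (n : nat) (e : rel 'I_n) (f g : 'I_n -> nat) :
  injective f -> injective g -> e =2 crosses f g -> permutation_graph e.
Proof.
move=> /rank_permutation[phi phiE] /rank_permutation[psi psiE] eE.
(* The second permutation sends the top position [phi u] to the bottom position [psi u]. *)
exists phi, (phi^-1 * psi)%g => u v.
by rewrite eE /perm_rel !permM !permK !phiE !psiE.
Qed.

Lemma trapezoid_graph_crosses (n : nat) (e : rel 'I_n) (f g : 'I_n -> nat) :
  injective f -> injective g -> e =2 crosses f g -> trapezoid_graph e.
Proof.
move=> f_inj g_inj eE.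
(* Each chord of the diagram is a degenerate trapezoid whose two sides are points. *)
exists (fun v => Trapezoid (INR (f v)) (INR (f v)) (INR (g v)) (INR (g v))).
split=> [v|u v]; first by split; apply: Rle_refl.
have INR_ltP (a b : nat) : reflect (Rlt (INR a) (INR b)) (a < b).
  by apply: (iffP ltP) => [/lt_INR|/INR_lt].
rewrite eE /trapezoids_intersect /crosses /=; split.
- move=> h; split; first by apply: contraTneq h => ->; rewrite ltnn.
  by case=> -[/INR_ltP a /INR_ltP b]; move: h; lia.
- case=> neq_uv h.
  have nf : f u != f v by rewrite (inj_eq f_inj).
  have ng : g u != g v by rewrite (inj_eq g_inj).
  apply: contra_notT h => h.
  have [[/INR_ltP a /INR_ltP b]|[/INR_ltP a /INR_ltP b]] :
    (f u < f v /\ g u < g v) \/ (f v < f u /\ g v < g u) by lia.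
  + by left.
  + by right.
Qed.

Lemma permutation_graph_trapezoid (n : nat) (e : rel 'I_n) :
  permutation_graph e -> trapezoid_graph e.
Proof.
case=> phi [pi eE].
apply: (@trapezoid_graph_crosses _ _ (fun u => phi u) (fun u => pi (phi u))).
- by move=> u v /val_inj/perm_inj.
- by move=> u v /val_inj/perm_inj/perm_inj.
- by move=> u v; rewrite eE.
Qed.

(** * Cocomparability graphs and asteroidal triples *)

Definition cocomparability (T : eqType) (E : rel T) : Prop :=
  exists L : T -> T -> Prop,
    [/\ forall u, ~ L u u,
        forall u v w, L u v -> L v w -> L u w &
        forall u v, u != v -> (~~ E u v <-> L u v \/ L v u)].

Lemma trapezoid_cocomparability (n : nat) (e : rel 'I_n) :
  trapezoid_graph e -> cocomparability e.
Proof.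
case=> T [validT eP].
exists (fun u v => Rlt (top_r (T u)) (top_l (T v)) /\
                   Rlt (bot_r (T u)) (bot_l (T v))); split.
- by move=> u; have [] := validT u; lra.
- by move=> u v w; have [] := validT v; lra.
- move=> u v neq_uv; split.
  + move=> nE; apply: Classical_Prop.NNPP => nL; case/negP: nE.
    exact/eP.
  + by move=> uLv; apply/negP => /eP[_]; apply.
Qed.

Lemma cocomparability_preim (S T : eqType) (d : S -> T) (E : rel T) :
  injective d -> cocomparability E -> cocomparability (relpre d E).
Proof.
move=> d_inj [L [Lirr Ltr LE]]; exists (fun u v => L (d u) (d v)).
split=> [u|u v w|u v neq_uv]; [exact: Lirr | exact: Ltr | apply: LE].
by rewrite (inj_eq d_inj).
Qed.

Definition avoids (T : eqType) (E : rel T) (c : T) : pred T :=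
  fun u => (u != c) && ~~ E u c.

(** A path that avoids a vertex and its neighbours stays on one side of it in the order [L]. Hence
    none of [a], [b], [c] lies between the other two; but they are pairwise comparable, so one of
    them must. *)
Lemma asteroidal_triple (T : eqType) (E : rel T) (a b c : T) (p q r : seq T) :
  symmetric E ->
  path E a p -> last a p = b -> all (avoids E c) (a :: p) ->
  path E b q -> last b q = c -> all (avoids E a) (b :: q) ->
  path E a r -> last a r = c -> all (avoids E b) (a :: r) ->
  ~ cocomparability E.
Proof.
move=> Esym ep pl pav eq ql qav er rl rav [L [Lirr Ltr LE]].
have irrE u v : E u v -> ~ L u v /\ ~ L v u.
  move=> Euv; have [uv|neq_uv] := eqVneq u v; first by rewrite uv.
  have nL : ~ (L u v \/ L v u) by move=> /(LE u v neq_uv).2; rewrite Euv.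
  by split=> Luv; apply: nL; [left | right].
(* Adjacent vertices avoiding [z] lie on the same side of [z]. *)
have side z s x : path E x s -> all (avoids E z) (x :: s) ->
    (L x z -> L (last x s) z) /\ (L z x -> L z (last x s)).
  elim: s x => [|y s IHs] x //= /andP[Exy es] /andP[_ av].
  have [IH1 IH2] := IHs y es av.
  have [nL nL'] := irrE _ _ Exy.
  have /andP[/andP[yz nE] _] := av.
  have [] := (LE y z yz).1 nE => Lyz.
    split=> Lx; first exact: IH1.
    by case: nL'; exact: Ltr Lyz Lx.
  split=> Lx; last exact: IH2.
  by case: nL; exact: Ltr Lx Lyz.
have comp x y : avoids E y x -> L x y \/ L y x.
  by case/andP=> xy; apply: (LE x y xy).1.
have [p1 p2] := side _ _ _ ep pav; rewrite pl in p1 p2.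
have [q1 q2] := side _ _ _ eq qav; rewrite ql in q1 q2.
have [r1 r2] := side _ _ _ er rav; rewrite rl in r1 r2.
have cab : L a b \/ L b a by apply: comp; case/andP: rav.
have cac : L a c \/ L c a by apply: comp; case/andP: pav.
have anti x y : L x y -> L y x -> False by move=> h /(Ltr _ _ _ h)/Lirr.
case: cab => h; case: cac => h'.
- by apply: (anti b c); [exact: p1 | exact: r1].
- by apply: (anti a c); first exact: q2.
- by apply: (anti a c); last exact: q1.
- by apply: (anti b c); [exact: r2 | exact: p2].
Qed.

(** * Counting certificate assignments; the pigeonhole argument *)

Lemma configuration_succ (c n : nat) (e : rel 'I_n) :
  0 < c -> symmetric e -> irreflexive e -> (forall u v, connect e u v) ->
  configuration c e (fun v => v.+1).
Proof.
move=> c_gt0 e_sym e_irr e_conn; split=> // [u v [/val_inj]|v] //=.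
have n_gt0 : 0 < n by exact: leq_trans (ltn_ord v).
by rewrite (leq_trans (ltn_ord v)) // -{1}[n]expn1 leq_pexp2l.
Qed.

Lemma neighbor_view_eq (n : nat) (e e' : rel 'I_n) id crt (v : 'I_n) :
  e v =1 e' v -> neighbor_view e id crt v = neighbor_view e' id crt v.
Proof. by move=> eq_v; rewrite /neighbor_view (eq_filter eq_v). Qed.

Lemma card_bool_bseq (k : nat) : #|{bseq k of bool}| <= 2 ^ k.+1.
Proof.
rewrite card_bseq card_bool; elim: k => [|k IHk]; first by rewrite big_ord1.
by rewrite big_ord_recr /= (expnS 2 k.+1) mul2n -addnn leq_add2r.
Qed.

Lemma leq_expr (a b m : nat) : a <= b -> a ^ m <= b ^ m.
Proof. by move=> le_ab; elim: m => // m IHm; rewrite !expnS leq_mul. Qed.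

(** All graphs share the identifiers [id], so once two of them share their certificates, a view
    depends on the neighbourhood alone. Soundness refutes only [~ P n e'], whence the double
    negation. *)
Lemma pls_collision (c n : nat) (P : forall n, rel 'I_n -> Prop) (V : verifier)
    (f : nat -> nat) (I : finType) (e : I -> rel 'I_n) (id : 'I_n -> nat) :
  is_PLS c P V f -> (forall i, configuration c (e i) id) ->
  (forall i, P n (e i)) -> 2 ^ ((f n).+1 * n) < #|I| ->
  exists i j, i != j /\
    forall e' : rel 'I_n, configuration c e' id ->
      (forall v, e' v =1 e i v \/ e' v =1 e j v) -> ~ ~ P n e'.
Proof.
move=> [complete sound] e_conf e_yes ltI.
pose label := {ffun 'I_n -> {bseq (f n) of bool}}.
pose accepts (i : I) (l : label) :=
  [forall v, V (id v, l v : cert) (neighbor_view (e i) id (fun u => l u) v)].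
have ex_label i : exists l, accepts i l.
  have [crt [size_crt acc]] := complete n (e i) id (e_conf i) (e_yes i).
  exists [ffun v => Bseq (size_crt v)]; apply/forallP => v.
  rewrite ffunE /= (_ : neighbor_view _ _ _ _ = neighbor_view (e i) id crt v).
    exact: acc.
  rewrite /neighbor_view; congr (sort _ _).
  by apply: eq_map => u; rewrite ffunE.
pose lab i := xchoose (ex_label i).
have /injectivePn[i [j neq_ij eq_lab]] : ~~ injectiveb lab.
  apply: contraTN ltI => /injectiveP/leq_card; rewrite -leqNgt => /leq_trans.
  by apply; rewrite card_ffun card_ord expnM leq_expr // card_bool_bseq.
exists i, j; split=> // e' e'_conf loc.
move=> /(sound _ _ _ e'_conf)/(_ (fun u => lab i u)).
apply=> v; case: (loc v) => /neighbor_view_eq ->.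
  exact: (forallP (xchooseP (ex_label i)) v).
by rewrite eq_lab; exact: (forallP (xchooseP (ex_label j)) v).
Qed.

(** The last [m] factors of the factorial all exceed [m]. *)
Lemma leq_expn_fact (m : nat) : m ^ m <= (m + m)`!.
Proof.
suff: forall i, m ^ i <= (m + i)`! by apply.
elim=> [|i IHi]; first by rewrite fact_gt0.
by rewrite expnS addnS factS leq_mul // ltnW // ltnS leq_addr.
Qed.

(** * The gadget graphs *)

Definition vertex (r t : nat) : finType := ('I_r.+1 + 'I_t * 'I_6)%type.

(* A component is drawn as a permutation diagram: its vertices 0, ..., 5, which
   are q, x1, p, y2, x2, y1, are numbered from left to right on the top line,
   and [bottom] gives their positions on the bottom line. *)
Definition bottom (a : 'I_6) : nat := nth 0 [:: 1; 4; 0; 5; 2; 3] a.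

(* The component containing vertex [a] of index [i]; 3 and 5 are y2 and y1. *)
Definition block (t : nat) (s : {perm 'I_t}) (i : 'I_t) (a : 'I_6) : 'I_t :=
  if (2 < a) && odd a then s i else i.

Arguments bottom : simpl never.
Arguments block : simpl never.

(* [x2 y2] is the only edge whose end points, 4 and 3, sum to 7. *)
Definition gadget (r t : nat) (s s' : {perm 'I_t}) : rel (vertex r t) :=
  fun u v =>
  match u, v with
  | inl k, inl l => k != l
  | inr (i, a), inr (j, b) => crosses (@nat_of_ord 6) bottom a b &&
      (let z := if a + b == 7 then s' else s in block z i a == block z j b)
  | _, _ => true
  end.

Lemma bottom_inj : injective bottom.
Proof.
rewrite /bottom; do 2!case=> [[|[|[|[|[|[|?]]]]]] ?] //=.
all: by move=> *; apply: val_inj.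
Qed.

Lemma ltn_bottom a : bottom a < 6.
Proof. by rewrite /bottom; case: a => [[|[|[|[|[|[|?]]]]]] ?]. Qed.

Lemma block_inj t (s : {perm 'I_t}) a : injective (block s ^~ a).
Proof. by rewrite /block => i j; case: ifP => // _ /perm_inj. Qed.

Lemma gadget_crosses r t (s : {perm 'I_t}) :
  exists f g : vertex r t -> nat,
    [/\ injective f, injective g & gadget s s =2 crosses f g].
Proof.
(* Components occupy consecutive slots of six positions on both lines, ordered by [block]. Universal
   chords start to the left of all slots and end to their right, in reversed order, so they also
   cross each other. *)
exists (fun u : vertex r t => match u with
  | inl k => val k | inr (i, a) => r.+1 + (6 * block s i a + a) end).
exists (fun u : vertex r t => match u with
  | inl k => 6 * t + (r - k) | inr (i, a) => 6 * block s i a + bottom a end).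
split.
- case=> [k|[i a]] [l|[j b]] /= h.
  + by congr inl; apply: val_inj.
  + by have := ltn_ord k; lia.
  + by have := ltn_ord l; lia.
  + have := ltn_ord a; have := ltn_ord b => hx hy.
    have eq_ab : a = b by apply: val_inj => /=; lia.
    rewrite -eq_ab in h *; congr (inr (_, _)).
    by apply: (@block_inj _ s a); apply: val_inj => /=; lia.
- case=> [k|[i a]] [l|[j b]] /= h.
  + have := ltn_ord k; have := ltn_ord l => hk hl.
    by congr inl; apply: val_inj => /=; lia.
  + by have := ltn_ord (block s j b); have := ltn_bottom b; lia.
  + by have := ltn_ord (block s i a); have := ltn_bottom a; lia.
  + have := ltn_bottom a; have := ltn_bottom b => hx hy.
    have eq_ab : a = b by apply: bottom_inj; lia.
    rewrite -eq_ab in h *; congr (inr (_, _)).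
    by apply: (@block_inj _ s a); apply: val_inj => /=; lia.
- case=> [k|[i a]] [l|[j b]] /=; rewrite /crosses.
  + by rewrite -val_eqE /=; have := ltn_ord k; have := ltn_ord l; lia.
  + have := ltn_ord k; have := ltn_ord (block s j b).
    by have := ltn_bottom b; lia.
  + have := ltn_ord l; have := ltn_ord (block s i a).
    by have := ltn_bottom a; lia.
  + rewrite if_same -val_eqE /=.
    have := ltn_ord a; have := ltn_ord b.
    by have := ltn_bottom a; have := ltn_bottom b; lia.
Qed.

Lemma gadget_sym r t (s s' : {perm 'I_t}) : symmetric (@gadget r t s s').
Proof.
case=> [k|[i a]] [l|[j b]] //=; first by rewrite eq_sym.
by rewrite addnC eq_sym /crosses orbC.
Qed.

Lemma gadget_irr r t (s s' : {perm 'I_t}) : irreflexive (@gadget r t s s').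
Proof. by case=> [k|[i a]] /=; rewrite ?eqxx // /crosses ltnn. Qed.

Lemma gadget_connect r t (s s' : {perm 'I_t}) u v :
  connect (@gadget r t s s') u v.
Proof.
have hub w : connect (@gadget r t s s') (inl ord0) w.
  have [->|neq_w] := eqVneq w (inl ord0); first exact: connect0.
  by apply: connect1; case: w neq_w => //= k; rewrite eq_sym.
apply: connect_trans (hub v).
by rewrite (sym_connect_sym (@gadget_sym r t s s')).
Qed.

(* The neighbourhoods of y2 and x2 (3 and 4) are those along [s']. *)
Lemma gadget_local r t (s s' : {perm 'I_t}) u :
  @gadget r t s s' u =1 gadget s s u \/ @gadget r t s s' u =1 gadget s' s' u.
Proof.
case: u => [k|[i a]]; first by left; case.
have [Ha|Ha] := boolP ((a : nat) \in [:: 3; 4]); [right | left].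
  move=> [//|[j b]]; move: Ha; rewrite /= /block /crosses /= !if_same.
  case: a => [[|[|[|[|[|[|?]]]]]] ?] //= _;
  by case: b => [[|[|[|[|[|[|?]]]]]] ?] //=; rewrite !(inj_eq perm_inj).
move=> [//|[j b]]; move: Ha; rewrite /= /block /crosses /= !if_same.
by case: a => [[|[|[|[|[|[|?]]]]]] ?] //= _;
   case: b => [[|[|[|[|[|[|?]]]]]] ?].
Qed.

Lemma gadget_mixed r t (s s' : {perm 'I_t}) :
  s != s' -> ~ cocomparability (@gadget r t s s').
Proof.
move=> neq_s.
have [j neq_j] : exists j, s j != s' j.
  apply/existsP; apply: contraNT neq_s => /existsPn eq_s.
  by apply/eqP/permP => j; apply/eqP; rewrite -[_ == _]negbK; exact: eq_s.
(* In component [i], y1 of index [j] is still attached to x1, but x2 is now adjacent to y2 of index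
   [j'] instead of [j]: the cycle is open. *)
pose i := s j; pose j' := (s'^-1)%g i.
have s'j' : s' j' = i by rewrite permKV.
have neq_jj' : j != j' by apply: contraNneq neq_j => eq_j; rewrite {2}eq_j s'j'.
pose x k a (lt_a : a < 6) : vertex r t := inr (k, Ordinal lt_a).
have neqx k l a b lt_a lt_b :
    (k != l) || (a != b) -> @x k a lt_a != @x l b lt_b.
  by case/orP; apply: contraNneq => -[eq_k eq_a]; apply/eqP.
pose q := @x i 0 isT; pose c := @x i 1 isT; pose p := @x i 2 isT.
pose y1 := @x j 5 isT; pose y2 := @x j 3 isT.
pose x2 := @x i 4 isT; pose y2' := @x j' 3 isT.
(* The leaves of the claw are [q], [y2], [y2']; each path runs along two legs through the center [c]
   and avoids the third leaf. *)
apply: (@asteroidal_triple _ _ q y2 y2' [:: p; c; y1; y2] [:: y1; c; x2; y2']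
          [:: p; c; x2; y2']) => //=; first exact: gadget_sym.
all: rewrite /avoids /q /c /p /y1 /y2 /x2 /y2' /= /crosses /bottom /block /=.
all: rewrite ?s'j' ?andbT ?eqxx //.
all: repeat (apply/andP; split); rewrite ?(inj_eq perm_inj) //.
all: by apply: neqx; rewrite orbC //= eq_sym.
Qed.

(** * Transfer to vertex sets ['I_n] and the final estimate *)

Definition on_ord (T : finType) (E : rel T) : rel 'I_#|T| :=
  relpre (fun i : 'I_#|T| => enum_val i) E.

Lemma on_ord_connect (T : finType) (E : rel T) :
  (forall u v, connect E u v) -> forall i j, connect (on_ord E) i j.
Proof.
move=> conn i j; have /connectP[p Ep ej] := conn (enum_val i) (enum_val j).
apply/connectP; exists (map enum_rank p).
  elim: p (i) Ep {ej} => //= x p IHp k /andP[Ekx Ep].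
  by rewrite IHp ?enum_rankK // /on_ord /= enum_rankK Ekx.
by apply: enum_val_inj; rewrite ej -[i in RHS]enum_valK last_map !enum_rankK.
Qed.

Lemma on_ord_cocomparability (T : finType) (E : rel T) :
  cocomparability (on_ord E) -> cocomparability E.
Proof.
move=> /(cocomparability_preim (@enum_rank_inj T)) [L [Lirr Ltr LE]].
exists L; split=> // u v /LE; rewrite /on_ord /= !enum_rankK; exact.
Qed.

(** Any class between permutation graphs and cocomparability graphs is covered, which treats both
    recognition problems at once. The fooling family is indexed by the permutations of ['I_t]. *)
Lemma pls_fact_bound (c r t : nat) (P : forall n, rel 'I_n -> Prop)
    (V : verifier) (f : nat -> nat) :
  let n := r.+1 + t * 6 in
  0 < c ->
  (forall n (e : rel 'I_n) (g h : 'I_n -> nat),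
     injective g -> injective h -> e =2 crosses g h -> P n e) ->
  (forall n (e : rel 'I_n), P n e -> cocomparability e) ->
  is_PLS c P V f -> t`! <= 2 ^ ((f n).+1 * n).
Proof.
move=> n c_gt0 crossP Pcocomp pls; rewrite leqNgt; apply/negP => lt_fact.
have card_n : #|vertex r t| = n by rewrite card_sum card_prod !card_ord.
rewrite -card_n in lt_fact.
pose G s s' := on_ord (@gadget r t s s').
have G_conf s s' : configuration c (G s s') (fun v => v.+1).
  apply: configuration_succ => // [u v|u|].
  - exact: gadget_sym.
  - exact: gadget_irr.
  - exact/on_ord_connect/gadget_connect.
rewrite -card_Sn in lt_fact.
have [s|s [s' [neq_s fooled]]] :=
  @pls_collision c _ P V f _ (fun s => G s s) _ pls (fun s => G_conf s s) _
    lt_fact.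
  have [g [h [g_inj h_inj ghE]]] := gadget_crosses r s.
  apply: (crossP _ _ (g \o enum_val) (h \o enum_val)).
  - exact: inj_comp enum_val_inj.
  - exact: inj_comp enum_val_inj.
  - by move=> i j; rewrite /G /on_ord /= ghE.
apply: (fooled (G s s') (G_conf s s')).
  move=> v; case: (@gadget_local r t s s' (enum_val v)) => loc; [left|right];
    by move=> w; exact: loc.
move=> /Pcocomp/on_ord_cocomparability; exact: gadget_mixed.
Qed.

Lemma pls_Omega_log (c : nat) (P : forall n, rel 'I_n -> Prop)
    (V : verifier) (f : nat -> nat) :
  0 < c ->
  (forall n (e : rel 'I_n) (g h : 'I_n -> nat),
     injective g -> injective h -> e =2 crosses g h -> P n e) ->
  (forall n (e : rel 'I_n), P n e -> cocomparability e) ->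
  is_PLS c P V f -> Omega_log f.
Proof.
(* The estimate below gives [l - 4 <= 32 * (k + 1)], so [l <= 32 * k + 36]. As [37 <= l] forces
   [1 <= k], this is at most [68 * k]. *)
move=> c_gt0 crossP Pcocomp pls; exists 68, (2 ^ 37); split=> // n le_n.
have n_gt0 : 0 < n by apply: leq_trans le_n; rewrite expn_gt0.
set l := trunc_log 2 n.
have le37 : 37 <= l by rewrite -(trunc_expnK 37 (isT : 1 < 2)) leq_trunc_log.
have /andP[le_l lt_l] := trunc_log_bounds (isT : 1 < 2) n_gt0.
rewrite -/l in le_l lt_l.
(* One universal vertex is set aside for connectivity; [r] more absorb the remainder, so that every
   order [n] is reached. *)
pose t := n.-1 %/ 6; pose r := n.-1 %% 6.
have nE : n = r.+1 + t * 6 by rewrite addSn addnC -divn_eq prednK.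
have := @pls_fact_bound c r t P V f c_gt0 crossP Pcocomp pls.
rewrite /= -nE; set k := f n => bound.
pose d := l - 4; pose m := 2 ^ d.
have lE : l = d + 4 by rewrite subnK // (leq_trans _ le37).
have le_mt : m + m <= t.
  have : 2 ^ l = m * 16 by rewrite lE expnD.
  have : 8 <= m by rewrite (@leq_pexp2l 2 3 d) //; lia.
  by rewrite /t; lia.
have : 2 ^ (d * m) <= 2 ^ (k.+1 * (32 * m)).
  rewrite expnM (leq_trans (leq_expn_fact m)) //.
  apply: leq_trans (leq_trans (leq_fact le_mt) bound) _.
  rewrite leq_exp2l // leq_mul2l ltnW //.
  by apply: leq_trans lt_l _; rewrite lE -addnS expnD mulnC.
rewrite leq_exp2l // mulnA leq_pmul2r ?expn_gt0 //; lia.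
Qed.

Theorem theorem5 (c : nat) (hc : 1 <= c) :
  (forall (V : verifier) (f : nat -> nat),
     is_PLS c permutation_graph V f -> Omega_log f) /\
  (forall (V : verifier) (f : nat -> nat),
     is_PLS c trapezoid_graph V f -> Omega_log f).
Proof.
split=> V f; apply: pls_Omega_log => // n e.
- exact: permutation_graph_crosses.
- by move/permutation_graph_trapezoid; exact: trapezoid_cocomparability.
- exact: trapezoid_graph_crosses.
- exact: trapezoid_cocomparability.
Qed.
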